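(* Let $\mathbb{F}$ be a field of characteristic different from $2$, let $n\geq 3$, and let $\mathcal{A}$ be a division $*$-algebra which is one of: $\mathbb{F}$, a binarion algebra $\mathcal{B}(\mathbb{F})$, or a quaternion algebra $\mathcal{Q}(\mathbb{F})$ (as defined in the context). Let $H_n(\mathcal{A})$ be the Jordan algebra of self-adjoint $n\times n$ matrices over $\mathcal{A}$. Then every 2-local inner derivation on $H_n(\mathcal{A})$ is a derivation.
   Context: $\mathbb{F}$ carries the trivial involution. $\mathcal{B}(\mathbb{F})$ is the associative unital algebra with basis $\mathbf{1},i$, $i^2=\lambda\mathbf{1}$ ($\lambda\in\mathbb{F}\setminus\{0\}$), with involution $\overline{\alpha_0\mathbf{1}+\alpha_1 i}=\alpha_0\mathbf{1}-\alpha_1 i$. $\mathcal{Q}(\mathbb{F})$ is the associative unital algebra with basis $\mathbf{1},i,j,k$, $i^2=\lambda\mathbf{1}$, $j^2=\mu\mathbf{1}$, $ij=-ji=k$ ($\lambda,\mu\in\mathbb{F}\setminus\{0\}$), with involution $\overline{\alpha_0\mathbf{1}+\alpha_1i+\alpha_2j+\alpha_3k}=\alpha_0\mathbf{1}-\alpha_1i-\alpha_2j-\alpha_3k$. $M_n(\mathcal{A})$ has involution $(a_{i,j})^*=(\overline{a_{j,i}})$, and $H_n(\mathcal{A})=\{x\in M_n(\mathcal{A}):x^*=x\}$ with Jordan product $a\circ b=\frac12(ab+ba)$. A derivation is a linear map $D$ with $D(x\circ y)=D(x)\circ y+x\circ D(y)$. An inner derivation is a map $x\mapsto\sum_{k=1}^m\big(a_k\circ(b_k\circ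 x)-b_k\circ(a_k\circ x)\big)$ with $a_k,b_k\in H_n(\mathcal{A})$. A 2-local inner derivation is a map $\Delta:H_n(\mathcal{A})\to H_n(\mathcal{A})$ (not assumed linear) such that for every $x,y$ there is an inner derivation $D$ with $\Delta(x)=D(x)$, $\Delta(y)=D(y)$. *)

(* Defs.v *)
From mathcomp Require Import all_boot all_order all_algebra.
Set Implicit Arguments. Unset Strict Implicit. Unset Printing Implicit Defensive.
Import GRing.Theory.
Local Open Scope ring_scope.

(* Elements a0 1 + a1 i + a2 j + a3 k of the quaternion algebra Q(F)
   with i^2 = lam, j^2 = mu, ij = -ji = k. *)
Record quat (F : Type) := Quat { q0 : F; q1 : F; q2 : F; q3 : F }.

Section Quat.
Variable F : fieldType.

Definition qzero : quat F := Quat 0 0 0 0.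
Definition qone : quat F := Quat 1 0 0 0.
Definition qadd (a b : quat F) : quat F :=
  Quat (q0 a + q0 b) (q1 a + q1 b) (q2 a + q2 b) (q3 a + q3 b).
Definition qscale (c : F) (a : quat F) : quat F :=
  Quat (c * q0 a) (c * q1 a) (c * q2 a) (c * q3 a).
Definition qconj (a : quat F) : quat F :=
  Quat (q0 a) (- q1 a) (- q2 a) (- q3 a).
(* multiplication: i^2 = lam, j^2 = mu, k^2 = -lam mu, ij = -ji = k,
   ik = -ki = lam j, kj = -jk = mu i *)
Definition qmul (lam mu : F) (a b : quat F) : quat F :=
  Quat (q0 a * q0 b + lam * q1 a * q1 b + mu * q2 a * q2 b
          - lam * mu * q3 a * q3 b)
       (q0 a * q1 b + q1 a * q0 b - mu * q2 a * q3 b + mu * q3 a * q2 b)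
       (q0 a * q2 b + q2 a * q0 b + lam * q1 a * q3 b - lam * q3 a * q1 b)
       (q0 a * q3 b + q3 a * q0 b + q1 a * q2 b - q2 a * q1 b).

(* Which of the three algebras: F, B(F) = span(1,i), Q(F) = span(1,i,j,k).
   F and B(F) are realised as the *-subalgebras of Q(F) (same lam). *)
Inductive alg_kind := KindF | KindB | KindQ.

Definition inA (k : alg_kind) (a : quat F) : Prop :=
  match k with
  | KindF => q1 a = 0 /\ q2 a = 0 /\ q3 a = 0
  | KindB => q2 a = 0 /\ q3 a = 0
  | KindQ => True
  end.

Definition is_division (k : alg_kind) (lam mu : F) : Prop :=
  forall a, inA k a -> a <> qzero ->
    exists b, inA k b /\ qmul lam mu a b = qone /\ qmul lam mu b a = qone.

Variable n : nat.
Notation MQ := 'M[quat F]_n.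

Definition mzero : MQ := \matrix_(i, j) qzero.
Definition madd (X Y : MQ) : MQ := \matrix_(i, j) qadd (X i j) (Y i j).
Definition mscale (c : F) (X : MQ) : MQ := \matrix_(i, j) qscale c (X i j).
Definition mmul (lam mu : F) (X Y : MQ) : MQ :=
  \matrix_(i, j) \big[qadd/qzero]_(l < n) qmul lam mu (X i l) (Y l j).
Definition mstar (X : MQ) : MQ := \matrix_(i, j) qconj (X j i).

Definition inH (k : alg_kind) (X : MQ) : Prop :=
  (forall i j, inA k (X i j)) /\ mstar X = X.

Definition jprod (lam mu : F) (X Y : MQ) : MQ :=
  mscale (2%:R)^-1 (madd (mmul lam mu X Y) (mmul lam mu Y X)).

Definition inner_der (lam mu : F) (s : seq (MQ * MQ)) (X : MQ) : MQ :=
  \big[madd/mzero]_(p <- s)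
     madd (jprod lam mu p.1 (jprod lam mu p.2 X))
          (mscale (-1) (jprod lam mu p.2 (jprod lam mu p.1 X))).

Definition pairs_in_H (k : alg_kind) (s : seq (MQ * MQ)) : Prop :=
  forall i, (i < size s)%N -> inH k (nth (mzero, mzero) s i).1 /\ inH k (nth (mzero, mzero) s i).2.

Definition two_local_inner_der (k : alg_kind) (lam mu : F) (D : MQ -> MQ) : Prop :=
  (forall X, inH k X -> inH k (D X)) /\
  forall X Y, inH k X -> inH k Y ->
    exists s, pairs_in_H k s /\ D X = inner_der lam mu s X
                             /\ D Y = inner_der lam mu s Y.

Definition is_derivation_H (k : alg_kind) (lam mu : F) (D : MQ -> MQ) : Prop :=
  (forall (c : F) X Y, inH k X -> inH k Y ->
     D (madd (mscale c X) Y) = madd (mscale c (D X)) (D Y)) /\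
  (forall X Y, inH k X -> inH k Y ->
     D (jprod lam mu X Y) = madd (jprod lam mu (D X) Y) (jprod lam mu X (D Y))).

End Quat.

(* Main.v *)
(** Every map [x |-> a o (b o x) - b o (a o x)] is a commutator with
    [[a, b] / 4], so it is skew for the trace form [Re tr (x y)], which is
    nondegenerate on [H_n(A)]. Testing the 2-local map [D] on a pair [x, z]
    gives [Re tr (D x z) = - Re tr (x (D z))] for all [x, z] in [H_n(A)]; the
    right-hand side is linear in [x], hence so is [D]. Testing [D] on the pair
    [x, x^2] gives [D (x^2) = 2 x o D x], and polarization concludes. *)
Require Import Defs.
From HB Require Import structures.
From mathcomp Require Import all_boot all_order all_algebra.
From mathcomp Require Import ring.
Set Implicit Arguments.
Unset Strict Implicit.
Unset Printing Implicit Defensive.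
Import GRing.Theory.
Local Open Scope ring_scope.

(** * The quaternion algebra as an associative ring with involution *)

(* The alias carries the structure constants, so that the ring structure,
   which depends on them, can be inferred from the type. *)
Definition quatalg (F : fieldType) (lam mu : F) := quat F.

Section QuaternionRing.
Variables (F : fieldType) (lam mu : F).
Local Notation Q := (quatalg lam mu).

Lemma quat_eq (a b : quat F) :
  q0 a = q0 b -> q1 a = q1 b -> q2 a = q2 b -> q3 a = q3 b -> a = b.
Proof. by case: a b => [? ? ? ?] [? ? ? ?] /= -> -> -> ->. Qed.

(** The bijection with $\mathbb{F}^4$ transports decidable equality and choice, which the ring
    structures presuppose. *)
Definition quat_coords (a : Q) : F * F * F * F := (q0 a, q1 a, q2 a, q3 a).
Definition coords_quat (c : F * F * F * F) : Q :=
  Quat c.1.1.1 c.1.1.2 c.1.2 c.2.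

Lemma quat_coordsK : cancel quat_coords coords_quat.
Proof. by case. Qed.

HB.instance Definition _ := Choice.copy Q (can_type quat_coordsK).

Definition qopp (a : Q) : Q := Quat (- q0 a) (- q1 a) (- q2 a) (- q3 a).

Lemma qaddA : associative (@qadd F : Q -> Q -> Q).
Proof. by move=> a b c; apply: quat_eq; rewrite /= addrA. Qed.

Lemma qaddC : commutative (@qadd F : Q -> Q -> Q).
Proof. by move=> a b; apply: quat_eq; rewrite /= addrC. Qed.

Lemma qadd0 : left_id (qzero F : Q) (@qadd F).
Proof. by move=> a; apply: quat_eq; rewrite /= add0r. Qed.

Lemma qaddN : left_inverse (qzero F : Q) qopp (@qadd F).
Proof. by move=> a; apply: quat_eq; rewrite /= addNr. Qed.

HB.instance Definition _ := GRing.isZmodule.Build Q qaddA qaddC qadd0 qaddN.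

Lemma qmulA : associative (qmul lam mu : Q -> Q -> Q).
Proof. by move=> a b c; apply: quat_eq => /=; ring. Qed.

Lemma qmul1l : left_id (qone F : Q) (qmul lam mu).
Proof. by move=> a; apply: quat_eq => /=; ring. Qed.

Lemma qmul1r : right_id (qone F : Q) (qmul lam mu).
Proof. by move=> a; apply: quat_eq => /=; ring. Qed.

Lemma qmulDl : left_distributive (qmul lam mu : Q -> Q -> Q) (@qadd F).
Proof. by move=> a b c; apply: quat_eq => /=; ring. Qed.

Lemma qmulDr : right_distributive (qmul lam mu : Q -> Q -> Q) (@qadd F).
Proof. by move=> a b c; apply: quat_eq => /=; ring. Qed.

Lemma qone_neq0 : (qone F : Q) != qzero F.
Proof. by apply/eqP => -[] /eqP; rewrite oner_eq0. Qed.

HB.instance Definition _ := GRing.Zmodule_isNzRing.Build Q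
  qmulA qmul1l qmul1r qmulDl qmulDr qone_neq0.

Definition qre (a : Q) : F := q0 a.

Lemma qre_is_zmod_morphism : zmod_morphism qre.
Proof. by []. Qed.

HB.instance Definition _ := GRing.isZmodMorphism.Build Q F qre qre_is_zmod_morphism.

Lemma qreC (a b : Q) : qre (a * b) = qre (b * a).
Proof. by rewrite /qre /=; ring. Qed.

(** Scaling is recast as multiplication by a central element, so that ring identities alone suffice
    later and no module structure over [F] is set up. *)
Definition qscalar (c : F) : Q := Quat c 0 0 0.

Lemma qscaleE (c : F) (a : Q) : qscale c a = qscalar c * a.
Proof. by apply: quat_eq => /=; ring. Qed.

Lemma qscalarC (c : F) (a : Q) : qscalar c * a = a * qscalar c.
Proof. by apply: quat_eq => /=; ring. Qed.

Lemma qconjM (a b : Q) : (qconj (a * b) : Q) = (qconj b : Q) * (qconj a : Q).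
Proof. by apply: quat_eq => /=; ring. Qed.

Lemma qconjD (a b : Q) : (qconj (a + b) : Q) = (qconj a : Q) + (qconj b : Q).
Proof. by apply: quat_eq => /=; ring. Qed.

Lemma qconj0 : qconj (0 : Q) = (0 : Q).
Proof. by apply: quat_eq => /=; ring. Qed.

Lemma qconj_scalar (c : F) : qconj (qscalar c) = qscalar c.
Proof. by apply: quat_eq; rewrite /= ?oppr0. Qed.

Lemma qconjK : involutive (@qconj F : Q -> Q).
Proof. by move=> a; apply: quat_eq => /=; rewrite ?opprK. Qed.

End QuaternionRing.

Arguments qscalar {F lam mu} c.
Arguments qre {F lam mu} a : simpl never.

(** * Closure properties of $\mathcal{A}$ and nondegeneracy of its real-part form *)

Section Subalgebra.
Variables (F : fieldType) (k : alg_kind) (lam mu : F).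
Local Notation Q := (quatalg lam mu).

Lemma inA_scalar c : inA k (qscalar c : Q).
Proof. by case: k. Qed.

Lemma inA0 : inA k (0 : Q).
Proof. by case: k. Qed.

Lemma inA_add (a b : Q) : inA k a -> inA k b -> inA k (a + b).
Proof.
case: k => //= [[-> [-> ->]] [-> [-> ->]]|[-> ->] [-> ->]]; by rewrite addr0.
Qed.

Lemma inA_mul (a b : Q) : inA k a -> inA k b -> inA k (a * b).
Proof.
case: k => //= [[-> [-> ->]] [-> [-> ->]]|[-> ->] [-> ->]];
  by rewrite !(mulr0, mul0r, addr0, subr0).
Qed.

Lemma inA_conj (a : Q) : inA k a -> inA k (qconj a).
Proof. by case: k => //= [[-> [-> ->]]|[-> ->]]; rewrite oppr0. Qed.

Lemma inA_sum (I : Type) (r : seq I) (P : pred I) (f : I -> Q) :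
  (forall i, inA k (f i)) -> inA k (\sum_(i <- r | P i) f i).
Proof. by move=> fA; elim/big_ind: _ => //; [apply: inA0|apply: inA_add]. Qed.

(** In the basis $1,i,j,k$ the form $\mathrm{Re}(zu)$ is diagonal with nonzero entries
    $1,\lambda,\mu,-\lambda\mu$, so testing against a basis element isolates one coordinate. *)
Lemma qre_nondegenerate (z : Q) : lam != 0 -> mu != 0 -> inA k z ->
  (forall u : Q, inA k u -> qre (z * u) = 0) -> z = 0.
Proof.
move=> lam0 mu0 zA zu0.
have z0 : q0 z = 0.
  by rewrite -[z]mulr1; apply: zu0; apply: (inA_scalar 1).
(* A basis element is an admissible test only if it lies in $\mathcal{A}$; otherwise [zA] already
   says that the coordinate vanishes. *)
have z1 : inA k (Quat 0 1 0 0 : Q) -> q1 z = 0.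
  move=> /zu0 /eqP; rewrite /qre /= !(mulr0, mulr1, addr0, subr0, add0r).
  by rewrite mulf_eq0 (negPf lam0) => /eqP.
have z2 : inA k (Quat 0 0 1 0 : Q) -> q2 z = 0.
  move=> /zu0 /eqP; rewrite /qre /= !(mulr0, mulr1, addr0, subr0, add0r).
  by rewrite mulf_eq0 (negPf mu0) => /eqP.
have z3 : inA k (Quat 0 0 0 1 : Q) -> q3 z = 0.
  move=> /zu0 /eqP; rewrite /qre /= !(mulr0, mulr1, addr0, add0r) oppr_eq0.
  by rewrite !mulf_eq0 (negPf lam0) (negPf mu0) => /eqP.
by clear zu0; case: k zA z1 z2 z3 => [[? [? ?]]|[? ?]|_] z1 z2 z3;
  apply: quat_eq => //; [apply: z1|apply: z1|apply: z2|apply: z3].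
Qed.

End Subalgebra.

(** * Jordan products and commutators in an associative ring *)

(* Only the centrality of [h] matters here; the theorem uses [h = 1/2]. *)
Section JordanProduct.
Variables (R : pzRingType) (h : R).
Hypothesis hC : forall x, h * x = x * h.

Definition jordan (x y : R) := h * (x * y + y * x).

Lemma jordanC x y : jordan x y = jordan y x.
Proof. by rewrite /jordan addrC. Qed.

Lemma jordanDl x y z : jordan (x + y) z = jordan x z + jordan y z.
Proof. by rewrite /jordan -mulrDr mulrDl (mulrDr z) addrACA. Qed.

Lemma jordanDr x y z : jordan x (y + z) = jordan x y + jordan x z.
Proof. by rewrite !(jordanC x) jordanDl. Qed.

(** In the expansion, the terms $axb$ and $bxa$ with $x$ in the middle cancel; the remaining ones
    have $x$ at an end and group into a commutator. *)
Lemma jordan_commutator a b x :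
  jordan a (jordan b x) - jordan b (jordan a x) =
  h * h * (a * b - b * a) * x - x * (h * h * (a * b - b * a)).
Proof.
have nested u v : jordan u (jordan v x) =
    h * h * (u * v * x + u * x * v + (v * x * u + x * v * u)).
  rewrite /jordan (mulrA u) -(hC u) -!(mulrA h) -mulrDr.
  by congr (h * (h * _)); rewrite mulrDr mulrDl !mulrA.
have hhC u : h * h * u = u * (h * h) by rewrite -mulrA hC -mulrA hC mulrA.
rewrite !nested (mulrA x) -hhC -!(mulrA (h * h)) -!mulrBr; congr (_ * _).
rewrite !mulrBl !mulrBr !mulrA (addrC (b * x * a)) addrACA.
rewrite (addrC (a * x * b) (x * a * b)) [X in _ - X]addrACA (addrC (b * x * a)).
by rewrite (addrC (b * a * x + _)) addrKA opprB [RHS]addrACA -opprD.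
Qed.

(** A commutator with $m$ is a derivation of the associative product, and the central factor [h]
    passes through it. *)
Lemma jordan_commutator_derivation m x y :
  m * jordan x y - jordan x y * m =
  jordan (m * x - x * m) y + jordan x (m * y - y * m).
Proof.
rewrite /jordan -mulrDr -mulrA mulrA -hC -mulrA -mulrBr; congr (h * _).
rewrite !mulrDr !mulrDl !mulrN !mulNr !mulrA.
by rewrite [RHS]addrACA subrKA (addrC (y * m * x - _)) subrKA [RHS]addrACA -opprD.
Qed.

End JordanProduct.

(** * Hermitian matrices and the trace form *)

Section HermitianMatrices.
Variables (F : fieldType) (k : alg_kind) (lam mu : F) (n : nat).
Local Notation Q := (quatalg lam mu).
Local Notation M := 'M[Q]_n.

(** This and the similar equations below trade the entrywise operations of the statement for those
    of the matrix ring over [quatalg]. *)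
Lemma maddE (X Y : M) : madd X Y = X + Y.
Proof. by apply/matrixP => i j; rewrite !mxE. Qed.

Lemma mzeroE : mzero F n = (0 : M).
Proof. by apply/matrixP => i j; rewrite !mxE. Qed.

Lemma mmulE (X Y : M) : mmul lam mu X Y = X * Y.
Proof. by apply/matrixP => i j; rewrite !mxE. Qed.

Definition mscalar (c : F) : M := (qscalar c)%:M.

Lemma mscalar_mul (c : F) (X : M) : mscalar c * X = qscalar c *: X.
Proof. exact: mul_scalar_mx. Qed.

Lemma mscaleE (c : F) (X : M) : mscale c X = mscalar c * X.
Proof. by apply/matrixP => i j; rewrite mscalar_mul !mxE -qscaleE. Qed.

Lemma mscalarC (c : F) (X : M) : mscalar c * X = X * mscalar c.
Proof.
apply/matrixP => i j; rewrite mscalar_mul !mxE (bigD1 j) //= big1 => [|l lj].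
  by rewrite !mxE eqxx mulr1n addr0 qscalarC.
by rewrite !mxE (negPf lj) mulr0n mulr0.
Qed.

Lemma mscalar1 (X : M) : mscalar 1 * X = X.
Proof.
by rewrite mscalar_mul; apply/matrixP => i j; rewrite !mxE -qscaleE;
  apply: quat_eq; rewrite /= mul1r.
Qed.

Lemma mscalar_half (X : M) : (2%:R : F) != 0 -> mscalar 2^-1 * (X + X) = X.
Proof.
move=> two0; have half (x : F) : 2^-1 * (x + x) = x.
  by rewrite -mulr2n -[x *+ 2]mulr_natl mulKf.
by rewrite mscalar_mul; apply/matrixP => i j; rewrite !mxE -qscaleE;
  apply: quat_eq; rewrite /= half.
Qed.

Lemma jprodE (X Y : M) : jprod lam mu X Y = jordan (mscalar 2^-1) X Y.
Proof. by rewrite /jprod mscaleE maddE !mmulE. Qed.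

Lemma mscaleN1 (X : M) : mscale (-1) X = - X.
Proof. by apply/matrixP => i j; rewrite !mxE; apply: quat_eq; rewrite /= mulN1r. Qed.

(** Commutators are additive in their first argument, so a single [m], depending on [s] alone,
    represents the whole sum. *)
Lemma inner_der_commutator (s : seq (M * M)) :
  exists m : M, forall X : M, inner_der lam mu s X = m * X - X * m.
Proof.
elim: s => [|[a b] s [m IHs]].
  by exists 0 => X; rewrite /inner_der big_nil mul0r mulr0 subrr mzeroE.
pose h := mscalar 2^-1.
exists (h * h * (a * b - b * a) + m) => X.
rewrite /inner_der big_cons -/(inner_der _ _ s X) IHs /= !jprodE.
rewrite mscaleN1 !maddE (jordan_commutator (mscalarC _)).
by rewrite (mulrDl _ m) (mulrDr X _ m) opprD addrACA.
Qed.

Definition trform (X Y : M) : F := qre (\tr (X * Y)).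

Lemma trformE X Y : trform X Y = \sum_i \sum_j qre (X i j * Y j i).
Proof.
rewrite /trform raddf_sum; apply: eq_bigr => i _.
by rewrite mxE raddf_sum.
Qed.

Lemma trformC X Y : trform X Y = trform Y X.
Proof.
rewrite !trformE exchange_big; apply: eq_bigr => i _; apply: eq_bigr => j _.
exact: qreC.
Qed.

Lemma trformDl X Y Z : trform (X + Y) Z = trform X Z + trform Y Z.
Proof. by rewrite /trform mulrDl !raddfD. Qed.

Lemma trformNl X Z : trform (- X) Z = - trform X Z.
Proof. by rewrite /trform mulNr !raddfN. Qed.

Lemma trformZl c X Z : trform (mscalar c * X) Z = c * trform X Z.
Proof.
rewrite !trformE big_distrr; apply: eq_bigr => i _.
rewrite big_distrr; apply: eq_bigr => j _.
by rewrite mscalar_mul mxE -qscaleE /qre /=; ring.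
Qed.

Lemma trform_mulA X Y Z : trform (X * Y) Z = trform X (Y * Z).
Proof. by rewrite /trform mulrA. Qed.

(** Cyclicity of the real trace: the terms $mXY$ and $XYm$ have the same value, as do $XmY$ on both
    sides. *)
Lemma trform_commutator m X Y :
  trform (m * X - X * m) Y = - trform X (m * Y - Y * m).
Proof.
rewrite (trformC X) !trformDl !trformNl opprB.
by rewrite (trform_mulA Y) (trformC Y) (trformC (m * Y)) (trform_mulA X).
Qed.

Lemma inHP (X : M) : inH k X <->
  (forall i j, inA k (X i j)) /\ (forall i j, qconj (X j i) = X i j).
Proof.
split=> -[XA XS]; split=> //; first by move=> i j; rewrite -[in RHS]XS mxE.
by apply/matrixP => i j; rewrite mxE XS.
Qed.

Lemma inH_add (X Y : M) : inH k X -> inH k Y -> inH k (X + Y).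
Proof.
move=> /inHP[XA XS] /inHP[YA YS]; apply/inHP.
by split=> i j; rewrite !mxE; [apply: inA_add|rewrite qconjD XS YS].
Qed.

Lemma inH_scale c (X : M) : inH k X -> inH k (mscalar c * X).
Proof.
move=> /inHP[XA XS]; apply/inHP; split=> i j; rewrite !mscalar_mul !mxE.
  by apply: inA_mul => //; apply: inA_scalar.
by rewrite qconjM XS qconj_scalar qscalarC.
Qed.

Lemma inH_opp (X : M) : inH k X -> inH k (- X).
Proof. by rewrite -mscaleN1 mscaleE; apply: inH_scale. Qed.

(** The involution reverses products, so it exchanges the two summands; neither need be self-adjoint
    alone. *)
Lemma inH_anticommutator (X Y : M) : inH k X -> inH k Y -> inH k (X * Y + Y * X).
Proof.
move=> /inHP[XA XS] /inHP[YA YS]; apply/inHP; split=> i j; rewrite !mxE.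
  by apply: inA_add; apply: inA_sum => l; apply: inA_mul.
rewrite qconjD addrC; congr (_ + _ : Q).
all: rewrite (big_morph _ (@qconjD _ lam mu) (@qconj0 _ lam mu)).
all: by apply: eq_bigr => l _; rewrite qconjM XS YS.
Qed.

Lemma inH_jordan c (X Y : M) : inH k X -> inH k Y -> inH k (jordan (mscalar c) X Y).
Proof. by move=> XH YH; apply/inH_scale/inH_anticommutator. Qed.

(* Test matrices: [u] at [(j, i)] plus its conjugate at [(i, j)]. *)
Lemma trform_nondegenerate (Z : M) : (2%:R : F) != 0 -> lam != 0 -> mu != 0 ->
  inH k Z -> (forall Y, inH k Y -> trform Z Y = 0) -> Z = 0.
Proof.
move=> two0 lam0 mu0 /inHP[ZA ZS] ZY0; apply/matrixP => i j; rewrite [RHS]mxE.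
apply: (qre_nondegenerate lam0 mu0 (ZA i j)) => u uA.
pose E (a b : 'I_n) (v : Q) : M := \matrix_(p, q) (v *+ ((p == a) && (q == b))).
have trE a b v : trform Z (E a b v) = qre (Z b a * v).
  rewrite trformE (bigD1 b) //= (bigD1 a) //= mxE !eqxx mulr1n.
  rewrite !big1 ?addr0 //.
    move=> p pb; rewrite big1 // => q _.
    by rewrite mxE (negPf pb) andbF mulr0n mulr0 raddf0.
  by move=> q qa; rewrite mxE (negPf qa) mulr0n mulr0 raddf0.
(* Writing entries as multiples by a boolean covers $i=j$ too, where the two matrices overlap and
   add up to $u+\overline{u}$. *)
have EH : inH k (E j i u + E i j (qconj u)).
  apply/inHP; split=> p q; rewrite !mxE.
    by apply: inA_add; case: (_ && _); rewrite ?mulr1n ?mulr0n;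
      do ?[exact: inA0 | exact: inA_conj | exact: uA].
  rewrite qconjD addrC ![(q == _) && _]andbC.
  by congr (_ + _ : Q); case: (_ && _); rewrite ?mulr1n ?mulr0n ?qconj0 ?qconjK.
(* Since [Z] is self-adjoint, the second summand is the real part of a conjugate and equals the
   first, so $2\,\mathrm{Re}(Z_{ij}u)=0$. *)
have := ZY0 _ EH; rewrite trformC trformDl !(trformC _ Z) !trE -(ZS j i) -qconjM.
rewrite [X in _ + X](_ : _ = qre (u * Z i j)) // qreC.
by move/eqP; rewrite -mulr2n -mulr_natl mulf_eq0 (negPf two0) => /eqP.
Qed.

End HermitianMatrices.

(** Used with $a=DX\circ X$, $b=DX\circ Y$, $c=DY\circ X$, $d=DY\circ Y$ and $u=D(X\circ Y)$: the
    square terms drop out of the Leibniz rule for $(X+Y)^2$. *)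
Lemma polarization_cancel (V : zmodType) (a b c d u : V) :
  a + a + u + (u + (d + d)) = a + b + (c + d) + (a + b + (c + d)) ->
  u + u = b + c + (b + c).
Proof.
move=> E; apply: (addrI (a + a)); apply: (addIr (d + d)); move: E.
rewrite !addrA => ->; rewrite -!addrA (addrCA d a) (addrCA c a) (addrCA b a).
by rewrite (addrCA d b) (addrCA d c).
Qed.

(** * Linearity and the Leibniz rule for the 2-local map *)

Section TwoLocal.
Variables (F : fieldType) (k : alg_kind) (lam mu : F) (n : nat).
Local Notation M := 'M[quatalg lam mu]_n.
Variable D : M -> M.
Hypotheses (two_neq0 : (2%:R : F) != 0) (lam_neq0 : lam != 0) (mu_neq0 : mu != 0).
Hypothesis D_inH : forall X : M, inH k X -> inH k (D X).
Hypothesis D_local : forall X Y : M, inH k X -> inH k Y ->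
  exists m : M, D X = m * X - X * m /\ D Y = m * Y - Y * m.

Lemma local_skew (X Y : M) : inH k X -> inH k Y -> trform (D X) Y = - trform X (D Y).
Proof.
by move=> XH YH; have [m [-> ->]] := D_local XH YH; apply: trform_commutator.
Qed.

Lemma local_linear c (X Y : M) : inH k X -> inH k Y ->
  D (mscalar lam mu n c * X + Y) = mscalar lam mu n c * D X + D Y.
Proof.
move=> XH YH; have cXYH := inH_add (inH_scale c XH) YH.
apply/eqP; rewrite -subr_eq0; apply/eqP.
apply: (trform_nondegenerate (k := k)) => // [|Z ZH].
  by apply/inH_add/inH_opp/inH_add; [|apply: inH_scale|]; apply: D_inH.
(* Skewness moves every [D] onto the test matrix [Z], leaving an expression linear in the other
   argument. *)
rewrite trformDl trformNl [in X in _ - X]trformDl trformZl !local_skew //.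
by rewrite trformDl trformZl mulrN opprD subrr.
Qed.

Lemma local_additive (X Y : M) : inH k X -> inH k Y -> D (X + Y) = D X + D Y.
Proof. by move=> XH YH; rewrite -[X in X + Y]mscalar1 local_linear // mscalar1. Qed.

Local Notation J := (jordan (mscalar lam mu n 2^-1)).

Lemma local_square (X : M) : inH k X -> D (J X X) = J (D X) X + J (D X) X.
Proof.
move=> XH; have [m [DX ->]] := D_local XH (inH_jordan 2^-1 XH XH).
rewrite (jordan_commutator_derivation (mscalarC _)) -DX.
by rewrite (jordanC _ X).
Qed.

Lemma local_jordan (X Y : M) : inH k X -> inH k Y -> D (J X Y) = J (D X) Y + J X (D Y).
Proof.
move=> XH YH; rewrite (jordanC _ X (D Y)).
(* Polarization only yields $2D(X\circ Y)$, so both sides are doubled under a factor $1/2$ first. *)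
rewrite -[LHS](mscalar_half _ two_neq0) -[RHS](mscalar_half _ two_neq0).
congr (_ * _).
have JH (U V : M) : inH k U -> inH k V -> inH k (J U V) by apply: inH_jordan.
have [XX XY YY] := And3 (JH _ _ XH XH) (JH _ _ XH YH) (JH _ _ YH YH).
have := local_square (inH_add XH YH); rewrite (local_additive XH YH).
rewrite !jordanDl !jordanDr (jordanC _ Y X).
(* Generalizing keeps the rewriting below from unfolding Jordan products. *)
move: XX XY YY (local_square XH) (local_square YH).
move: (J X X) (J X Y) (J Y Y) => p q r pH qH rH Dp Dr.
rewrite (local_additive (inH_add pH qH) (inH_add qH rH)).
rewrite (local_additive pH qH) (local_additive qH rH) Dp Dr.
exact: polarization_cancel.
Qed.

End TwoLocal.

Unset Implicit Arguments.

Theorem theorem3p4 (F : fieldType) (n : nat) (k : alg_kind) (lam mu : F)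
  (D : 'M[quat F]_n -> 'M[quat F]_n) :
  (2%:R : F) != 0 -> (3 <= n)%N -> lam != 0 -> mu != 0 ->
  is_division k lam mu ->
  two_local_inner_der k lam mu D ->
  is_derivation_H k lam mu D.
Proof.
move=> two0 _ lam0 mu0 _ [DH Dlocal].
(* The list [s] is common to [X] and [Y], hence so is [m]. *)
have Dcomm (X Y : 'M[quatalg lam mu]_n) : inH k X -> inH k Y ->
    exists m : 'M[quatalg lam mu]_n, D X = m * X - X * m /\ D Y = m * Y - Y * m.
  move=> XH YH; have [s [_ [-> ->]]] := Dlocal X Y XH YH.
  by have [m mE] := @inner_der_commutator F lam mu n s; exists m; split; apply: mE.
split=> [c X Y XH YH|X Y XH YH].
  rewrite !(maddE (lam := lam) (mu := mu)) !(mscaleE (lam := lam) (mu := mu)).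
  exact: (local_linear two0 lam0 mu0 DH Dcomm).
rewrite !jprodE (maddE (lam := lam) (mu := mu)).
exact: (local_jordan two0 lam0 mu0 DH Dcomm).
Qed.
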